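(* Let $f$ be a norm on $\mathbb{R}^n$ and let $\{\theta_\nu\}_{\nu=1}^\infty\subset B_f^1$ be a sequence such that for each $\nu$ the point $0$, regarded as a point of the boundary $\partial B_f^1(\theta_\nu)$, is illuminated from the point $\theta_{\nu+1}$. Then there exists a vector $\alpha=(\alpha_1,\dots,\alpha_n)\in\mathbb{R}^n$ with $1,\alpha_1,\dots,\alpha_n$ linearly independent over $\mathbb{Q}$ such that $$\lim_{\nu\to+\infty}|\Xi_\nu-\theta_\nu|=0,$$ where $\Xi_\nu=\xi_\nu/f(\xi_\nu)$, $\xi_\nu=\alpha p_\nu-a_\nu$ and $(p_\nu,a_\nu)$ is the $\nu$-th $f$-best simultaneous approximation to $\alpha$.
   Context: A norm $f$ here is a continuous function $\mathbb{R}^n\to\mathbb{R}_+$ with $f(x)=0\iff x=0$, $f(-x)=f(x)$, $f(tx)=tf(x)$ for $t\ge0$, and convex unit ball $B_f^1=\{y:f(y)\le1\}$ with $0$ in its interior; $B_f^1(a)=\{y:f(y-a)\le1\}$. For a closed convex set $M\subset\mathbb{R}^n$, a point $b\in\partial M$ and a point $a\notin M$, $b$ is illuminated from $a$ if there is $\lambda>0$ with $b+\lambda(b-a)\in\operatorname{int}M$. For $\alpha\in\mathbb{R}^n$, an $f$-best simultaneous approximation is an integer point $\tau=(p,a_1,\dots,a_n)\in\mathbb{Z}^{n+1}$ with $p\ge1$ such that $f(\alpha q-b)>f(\alpha p-a)$ for all $(q,b)\in\mathbb{Z}^{n+1}$ with $1\le q\le p-1$ and for all $(p,b)$ with $b\ne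 a$. They form a sequence $(p_\nu,a_\nu)$ with $p_1<p_2<\dots$. *)

(* Defs.v *)
From HB Require Import structures.
From mathcomp Require Import all_boot all_order all_algebra.
From mathcomp Require Import all_classical all_reals all_analysis.
Set Implicit Arguments. Unset Strict Implicit. Unset Printing Implicit Defensive.
Import Order.TTheory GRing.Theory Num.Theory.
Import numFieldNormedType.Exports.
Local Open Scope classical_set_scope.
Local Open Scope ring_scope.

Section Defs.
Variables (R : realType) (n : nat).
Notation vec := 'rV[R]_n.

Definition ballf (f : vec -> R) (a : vec) : set vec := [set y | f (y - a) <= 1].

Definition is_norm (f : vec -> R) : Prop :=
  [/\ continuous f,
      (forall x, 0 <= f x),
      (forall x, f x = 0 <-> x = 0),
      (forall x, f (- x) = f x)
    & [/\ (forall (t : R) x, 0 <= t -> f (t *: x) = t * f x),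
      (forall x y (t : R), f x <= 1 -> f y <= 1 -> 0 <= t <= 1 ->
          f (t *: x + (1 - t) *: y) <= 1)
    & interior (ballf f 0) 0]].

Definition bdry (M : set vec) : set vec := closure M `\` interior M.

Definition illuminated (M : set vec) (b a : vec) : Prop :=
  [/\ bdry M b, ~ M a & exists2 lambda : R, 0 < lambda &
        interior M (b + lambda *: (b - a))].

Definition intv (a : 'rV[int]_n) : vec := map_mx (fun z : int => z%:~R) a.

Definition best_approx (f : vec -> R) (alpha : vec) (p : int) (a : 'rV[int]_n) : Prop :=
  [/\ (1 <= p)%R,
      (forall (q : int) (b : 'rV[int]_n), (1 <= q)%R -> (q <= p - 1)%R ->
          f (q%:~R *: alpha - intv b) > f (p%:~R *: alpha - intv a))
    & (forall b : 'rV[int]_n, b <> a ->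
          f (p%:~R *: alpha - intv b) > f (p%:~R *: alpha - intv a))].

(* (pa nu)_nu enumerates the f-best simultaneous approximations to alpha
   with strictly increasing denominators: pa nu is the (nu+1)-th one. *)
Definition best_approx_seq (f : vec -> R) (alpha : vec)
    (pa : nat -> int * 'rV[int]_n) : Prop :=
  [/\ (forall nu, best_approx f alpha (pa nu).1 (pa nu).2),
      (forall nu, ((pa nu).1 < (pa nu.+1).1)%R)
    & (forall p a, best_approx f alpha p a -> exists nu, pa nu = (p, a))].

Definition Q_lin_indep_1 (alpha : vec) : Prop :=
  forall (c0 : rat) (c : 'rV[rat]_n),
    ratr c0 + \sum_(i < n) ratr (c 0 i) * alpha 0 i = 0 -> c0 = 0 /\ c = 0.

Definition eucl (x : vec) : R := Num.sqrt (\sum_(i < n) x 0 i ^+ 2).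
End Defs.
Arguments intv {R n} a.

(* Main.v *)
(* The vector alpha is the limit of rational points a_nu / p_nu. Given a
   primitive point u = (p, a), project Z^(n+1) along u to a lattice in R^n and
   choose a lattice direction v close to theta_nu. The rational plane through u
   and (0, v) has a basis (u, u') with u' = (p', a') and p' arbitrarily large,
   such that a'/p' - a/p is a small positive multiple of v. Near alpha = a'/p'
   the lattice points off this plane stay at a distance that does not depend on
   p', while those on the plane give the multiples of xi = p alpha - a, whose
   direction is that of v. Hence for denominators at most p' the only
   competitor of u is u' - u, which ties with u at a'/p'. The tie is broken in
   favour of u by the illumination condition: f x < f (x - t y) for all t > 0
   when x and y are close to theta_nu and theta_(nu+1). Linear independence
   comes from avoiding, at step nu, the nu-th rational hyperplane. *)
Require Import Defs.
From HB Require Import structures.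
From mathcomp Require Import all_boot all_order all_algebra.
From mathcomp Require Import all_classical all_reals all_analysis.
From mathcomp Require Import ring lra zify.
Import Order.TTheory GRing.Theory Num.Theory.
Import numFieldNormedType.Exports.
Local Open Scope classical_set_scope.
Local Open Scope ring_scope.

Set Implicit Arguments.
Unset Strict Implicit.
Unset Printing Implicit Defensive.

(** * Norms given by a convex body *)

Lemma rV_norm_leP (R : realType) (n : nat) (x : 'rV[R]_n) (r : R) :
  0 <= r -> reflect (forall i, `|x 0 i| <= r) (`|x| <= r).
Proof.
move=> r0; rewrite [`|x|]/Num.Def.normr /= mx_normrE.
apply: (iffP (bigmax_leP _ _ _ _)) => [[_ H] i|H].
  exact: (H (0, i)).
by split=> // -[i j] _ /=; rewrite ord1.
Qed.

Lemma rV_norm_ge (R : realType) (n : nat) (x : 'rV[R]_n) i : `|x 0 i| <= `|x|.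
Proof. by move: i; apply/rV_norm_leP. Qed.

Lemma is_normZ (R : realType) (n : nat) (f : 'rV[R]_n -> R) :
  is_norm f -> forall t x, f (t *: x) = `|t| * f x.
Proof.
case=> _ _ _ fN [fZ _ _] t x.
case: (lerP 0 t) => [t0|/ltW t0]; first by rewrite ger0_norm ?fZ.
by rewrite ler0_norm // -fZ ?oppr_ge0 // scaleNr fN.
Qed.

Lemma is_norm_gt0 (R : realType) (n : nat) (f : 'rV[R]_n -> R) :
  is_norm f -> forall x, x <> 0 -> 0 < f x.
Proof.
by case=> _ f0 f00 _ _ x x0; rewrite lt_neqAle f0 andbT eq_sym; apply/eqP => /f00.
Qed.

Lemma is_norm_triangle (R : realType) (n : nat) (f : 'rV[R]_n -> R) :
  is_norm f -> forall x y, f (x + y) <= f x + f y.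
Proof.
move=> nf; have [_ f0 f00 fN [fZ fc _]] := nf => x y.
have [->|/eqP/(is_norm_gt0 nf) fx] := eqVneq x 0.
  by rewrite add0r lerDr.
have [->|/eqP/(is_norm_gt0 nf) fy] := eqVneq y 0.
  by rewrite addr0 lerDl.
have s0 : 0 < f x + f y by lra.
(* Weights proportional to [f x] and [f y] turn the combination of the normalised vectors into
   [(x + y) / (f x + f y)]. *)
have := fc ((f x)^-1 *: x) ((f y)^-1 *: y) (f x / (f x + f y)).
rewrite !fZ ?invr_ge0 // !mulVf ?gt_eqF //.
have -> : 0 <= f x / (f x + f y) <= 1.
  by rewrite divr_ge0 ?f0 ?(ltW s0) //= ler_pdivrMr // mul1r lerDl.
move/(_ (lexx _) (lexx _) isT).
have -> : f x / (f x + f y) *: ((f x)^-1 *: x)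
    + (1 - f x / (f x + f y)) *: ((f y)^-1 *: y) = (f x + f y)^-1 *: (x + y).
  rewrite !scalerA scalerDr; congr (_ *: _ + _ *: _); field;
  by rewrite ?gt_eqF.
by rewrite fZ ?invr_ge0 ?(ltW s0) // ler_pdivrMl // mulr1.
Qed.

Lemma is_norm_upper (R : realType) (n : nat) (f : 'rV[R]_n -> R) :
  is_norm f -> exists2 C, 0 < C & forall x, f x <= C * `|x|.
Proof.
move=> nf; have [_ _ f00 _ [fZ _ /nbhs_ballP[e /= e0 He]]] := nf.
exists (2 / e) => [|x]; first by rewrite divr_gt0.
have [->|x0] := eqVneq x 0; first by rewrite normr0 mulr0 (f00 0).2.
have nx : 0 < `|x| by rewrite normr_gt0.
have k0 : 0 < e / (2 * `|x|) by rewrite divr_gt0 ?mulr_gt0.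
have := He ((e / (2 * `|x|)) *: x).
rewrite -ball_normE /= sub0r normrN normrZ ger0_norm ?(ltW k0) //.
have -> : e / (2 * `|x|) * `|x| = e / 2 by field; rewrite gt_eqF.
rewrite /ballf /= subr0 fZ ?(ltW k0) // => H.
have := H ltac:(lra); rewrite -ler_pdivlMl // mulr1.
by rewrite invf_div mulrAC.
Qed.

(** The constant is the minimum of [f] on the compact unit sphere, which is empty when [n = 0]. *)
Lemma is_norm_lower (R : realType) (n : nat) (f : 'rV[R]_n -> R) :
  is_norm f -> exists2 c, 0 < c & forall x, c * `|x| <= f x.
Proof.
move=> nf; have [fcont f0 f00 _ [fZ _ _]] := nf.
pose S := [set x : 'rV[R]_n | `|x| = 1].
have [S0|S0] := pselect (S !=set0); last first.
  exists 1 => // x; suff -> : x = 0 by rewrite normr0 mulr0.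
  apply/eqP/negP => /negP x0; apply: S0; exists (`|x|^-1 *: x).
  by rewrite /S /= normrZ normfV normr_id mulVf // normr_eq0.
have cS : compact S.
  apply: bounded_closed_compact.
    by exists 1; split=> // M M1 x; rewrite /S /= => ->; apply: ltW.
  rewrite (_ : S = Num.Def.normr @^-1` [set 1]) //.
  apply: closed_comp => [x _|]; [exact: norm_continuous|exact: closed_eq].
have [z] := EVT_min_rV S0 cS (continuous_subspaceT fcont).
rewrite inE /S /= => z1 Hz.
exists (f z) => [|x].
  by apply: (is_norm_gt0 nf) => z0; move: z1; rewrite z0 normr0 => /esym/eqP; rewrite oner_eq0.
have [->|x0] := eqVneq x 0; first by rewrite normr0 mulr0 f0.
have nx : 0 < `|x| by rewrite normr_gt0.
have := Hz (`|x|^-1 *: x); rewrite inE /S /= normrZ normfV normr_id mulVf ?gt_eqF //.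
by move=> /(_ erefl); rewrite fZ ?invr_ge0 // ler_pdivlMl // mulrC.
Qed.

Lemma is_norm_normalize_cvg (R : realType) (n : nat) (f : 'rV[R]_n -> R) :
  is_norm f -> forall x (e : R), x <> 0 -> 0 < e ->
  exists2 d, 0 < d & forall y, `|y - x| <= d ->
    y <> 0 /\ `|(f y)^-1 *: y - (f x)^-1 *: x| < e.
Proof.
move=> nf x e x0 e0; have [fcont _ _ _ _] := nf.
have fx := is_norm_gt0 nf x0.
have : (fun y => (f y)^-1 *: y) @ x --> (f x)^-1 *: x.
  have fi : (fun y => (f y)^-1) @ x --> (f x)^-1.
    by apply: cvgV (fcont x); rewrite gt_eqF.
  exact: (cvgZ fi (@cvg_id _ _)).
move=> /cvgrPdist_lt /(_ e e0) /nbhs_normP [d /= d0 Hd].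
have nx : 0 < `|x| by rewrite normr_gt0; apply/eqP.
exists (Num.min (d / 2) (`|x| / 2)) => [|y].
  by rewrite lt_min !divr_gt0.
rewrite le_min => /andP[yd yx]; split.
  by move=> y0; move: yx; rewrite y0 sub0r normrN; lra.
rewrite distrC; apply: Hd => /=; rewrite distrC; lra.
Qed.

(** If [f a < 1], continuity would put [0] in the interior of the ball. Illumination makes
    [- l *: b] an interior point, and interior points have [f]-distance less than [1] from the
    centre [a]. *)
Lemma illuminated_ballf (R : realType) (n : nat) (f : 'rV[R]_n -> R) a b :
  is_norm f -> f a <= 1 -> illuminated (ballf f a) 0 b ->
  f a = 1 /\ exists2 l, 0 < l & f (a + l *: b) < 1.
Proof.
move=> nf fa [[_ nint] _ [l l0 /nbhs_normP[d /= d0 Hd]]].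
have [fcont f0 f00 fN [fZ _ _]] := nf.
split.
  apply/eqP; rewrite eq_le fa leNgt /=; apply/negP => fa1; apply: nint.
  have /cvgrPdist_lt/(_ (1 - f a)) := fcont (- a).
  rewrite subr_gt0 => /(_ fa1) /nbhs_normP[e /= e0 He].
  apply/(nbhs_normP (0 : 'rV[R]_n)); exists e => // y /=; rewrite sub0r => ye.
  have := He (y - a); rewrite /= opprB addKr => /(_ ye).
  by rewrite /ballf /= fN distrC => /ltr_normlW; lra.
exists l => //; set w := a + l *: b.
have [->|/eqP w0] := eqVneq w 0; first by rewrite (f00 0).2.
have fw := is_norm_gt0 nf w0.
have nw : 0 < `|w| by rewrite normr_gt0; apply/eqP.
have k0 : 0 < d / (2 * `|w|) by rewrite divr_gt0 ?mulr_gt0.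
(* The interior point is [a - w]; pushed away from [a] by the factor [1 + d / (2 * |w|)] it is still
   in the ball, hence [f w < 1]. *)
have := Hd (0 + l *: (0 - b) - (d / (2 * `|w|)) *: w).
rewrite /= opprB addrC subrK normrZ ger0_norm ?(ltW k0) //.
have -> : d / (2 * `|w|) * `|w| = d / 2 by field; rewrite gt_eqF.
move=> /(_ ltac:(lra)); rewrite /ballf /=.
have -> : 0 + l *: (0 - b) - (d / (2 * `|w|)) *: w - a = - ((1 + d / (2 * `|w|)) *: w).
  by apply/rowP => i; rewrite /w !mxE; ring.
rewrite fN fZ; last by lra.
nra.
Qed.

(* Convexity along the line [x + l *: y], [x], [x - t *: y]: since [f] drops
   from [x] towards [y], it must grow in the opposite direction. *)
Lemma is_norm_backward (R : realType) (n : nat) (f : 'rV[R]_n -> R) x y l t :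
  is_norm f -> 0 < l -> 0 < t -> f (x + l *: y) < f x -> f x < f (x - t *: y).
Proof.
move=> nf l0 t0 H; have [_ _ _ _ [fZ _ _]] := nf.
have := is_norm_triangle nf (t *: (x + l *: y)) (l *: (x - t *: y)).
have -> : t *: (x + l *: y) + l *: (x - t *: y) = (t + l) *: x.
  by apply/rowP => i; rewrite !mxE; ring.
rewrite !fZ ?addr_ge0 ?(ltW t0) ?(ltW l0) //; nra.
Qed.

Lemma is_norm_sub (R : realType) (n : nat) (f : 'rV[R]_n -> R) x y :
  is_norm f -> f y <= f x + f (x - y).
Proof.
move=> nf; have [_ _ _ fN _] := nf.
have := is_norm_triangle nf x (y - x).
by rewrite addrC subrK -(fN (y - x)) opprB.
Qed.

(** The strict drop of [f] from [a] to [a + l *: b] survives small changes of both vectors, and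
    [is_norm_backward] then covers all [t] with the same [d]. *)
Lemma illuminated_stable (R : realType) (n : nat) (f : 'rV[R]_n -> R) a b :
  is_norm f -> f a <= 1 -> illuminated (ballf f a) 0 b ->
  exists2 d, 0 < d & forall x y, `|x - a| <= d -> `|y - b| <= d ->
    forall t, 0 < t -> f x < f (x - t *: y).
Proof.
move=> nf fa1 /(illuminated_ballf nf fa1)[fa [l l0 Hl]].
have [C C0 HC] := is_norm_upper nf.
have fZ := is_normZ nf.
(* Passing from [a], [b] to [x], [y] costs at most [C * d] on [f a] and [(1 + l) * C * d] on
   [f (a + l *: b)]; the sum [D * d] is half of the drop. *)
pose D := (2 + l) * C.
have D0 : 0 < D by rewrite mulr_gt0 //; lra.
exists ((1 - f (a + l *: b)) / (2 * D)) => [|x y xa yb t t0].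
  by rewrite divr_gt0 ?subr_gt0 // mulr_gt0.
move: xa yb; set d := _ / _ => xa yb.
have dD : D * d = (1 - f (a + l *: b)) / 2 by rewrite /d; field; rewrite gt_eqF.
apply: (@is_norm_backward _ _ _ _ _ l) => //.
have H1 := is_norm_sub x a nf.
have H2 := is_norm_sub (a + l *: b) (x + l *: y) nf.
have H3 : f (x - a) <= C * d by apply: le_trans (HC _) _; rewrite ler_pM2l.
have H4 : f (y - b) <= C * d by apply: le_trans (HC _) _; rewrite ler_pM2l.
have H5 : f (a + l *: b - (x + l *: y)) <= C * d + l * (C * d).
  rewrite (_ : _ - _ = - (x - a) + (- l) *: (y - b)); last first.
    by apply/rowP => i; rewrite !mxE; ring.
  apply: le_trans (is_norm_triangle nf _ _) _.
  rewrite fZ -scaleN1r fZ !normrN normr1 mul1r gtr0_norm //.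
  by apply: lerD => //; rewrite ler_pM2l.
have : D * d = 2 * (C * d) + l * (C * d) by rewrite /D; ring.
lra.
Qed.

(** The estimates below use the maximum norm; this passes to the Euclidean norm of the
    conclusion. *)
Lemma eucl_le (R : realType) (n : nat) (x : 'rV[R]_n) :
  eucl x <= Num.sqrt n%:R * `|x|.
Proof.
rewrite /eucl -[X in _ * X]ger0_norm // -sqrtr_sqr -sqrtrM ?ler0n //.
apply: ler_wsqrtr; rewrite mulr_natl -[X in _ *+ X]card_ord -sumr_const.
apply: ler_sum => i _; rewrite -real_normK ?num_real //.
by rewrite ler_pXn2r ?nnegrE ?rV_norm_ge.
Qed.

(** * Bases of rational planes *)

(** For [p] nonzero, [q *: a = p *: b] says that [(q, b)] is proportional to [(p, a)]; this form
    avoids the gcd of the coordinates. *)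
Definition primitive_point (n : nat) (p : int) (a : 'rV[int]_n) : Prop :=
  forall (q : int) (b : 'rV[int]_n), q *: a = p *: b ->
    exists k : int, q = k * p /\ b = k *: a.

(* [(q, b)] lies in the rational plane spanned by [(p, a)] and [(0, v)]. *)
Definition in_plane (n : nat) (p : int) (a v : 'rV[int]_n) (i : 'I_n)
    (q : int) (b : 'rV[int]_n) : Prop :=
  forall j, v 0 i * (p * b 0 j - q * a 0 j) = v 0 j * (p * b 0 i - q * a 0 i).

(** On the plane, [p *: b - q *: a] is a rational multiple of [v], and the positive factor
    [v 0 i ^+ 2] makes the multiple an integer. The least positive one generates the others by
    Euclidean division. *)
Lemma plane_basis (n : nat) (p : int) (a v : 'rV[int]_n) (i : 'I_n) :
  0 < p -> primitive_point p a -> v 0 i != 0 ->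
  exists2 s : int, 0 < s & exists (q0 : int) (b0 : 'rV[int]_n),
    (forall j, v 0 i ^+ 2 * (p * b0 0 j - q0 * a 0 j) = s * v 0 j) /\
    (forall q b, in_plane p a v i q b ->
       exists k l : int, q = k * p + l * q0 /\ b = k *: a + l *: b0).
Proof.
move=> p0 pa vi.
have vi2 : 0 < v 0 i ^+ 2 by rewrite lt_neqAle sqr_ge0 andbT eq_sym sqrf_eq0.
pose P s := (0 < s)%N /\ exists (q : int) (b : 'rV[int]_n),
  forall j, v 0 i ^+ 2 * (p * b 0 j - q * a 0 j) = s%:Z * v 0 j.
have exP : exists s, `[< P s >].
  (* Witnessed by the point [(0, v)], which projects to [p *: v]. *)
  exists (absz (p * v 0 i ^+ 2)); apply/asboolP; split.
    by rewrite absz_gt0 gt_eqF // mulr_gt0.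
  exists 0, v => j; rewrite gez0_abs; [ring|exact/ltW/mulr_gt0].
case: (ex_minnP exP) => s /asboolP[s0 [q0 [b0 Hs]]] mins.
exists s%:Z; first by rewrite ltz_nat.
exists q0, b0; split=> // q b par.
(* [sg] is the integer multiple attached to [(q, b)]. Subtracting [d] times [(q0, b0)] leaves [r],
   which the minimality of [s] forces to vanish; the difference is then proportional to [(p, a)]. *)
pose sg := v 0 i * (p * b 0 i - q * a 0 i).
pose d := (sg %/ s%:Z)%Z; pose r := (sg %% s%:Z)%Z.
have sgE : sg = d * s%:Z + r by rewrite /d /r -divz_eq.
have s_neq0 : s%:Z != 0 by rewrite eqz_nat -lt0n.
have r_ge0 : 0 <= r by rewrite modz_ge0.
have r_lt : r < s%:Z by rewrite ltz_mod.
have Hr j : v 0 i ^+ 2 * (p * (b - d *: b0) 0 j - (q - d * q0) * a 0 j) = r * v 0 j.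
  have -> : r = sg - d * s%:Z by rewrite sgE; ring.
  rewrite [RHS]mulrBl -[d * _ * _]mulrA -Hs !mxE.
  have -> : sg * v 0 j = v 0 i * (v 0 i * (p * b 0 j - q * a 0 j)).
    by rewrite par /sg; ring.
  ring.
have r0 : r = 0.
  apply/eqP; case: (eqVneq r 0) => // r_neq0.
  have : (s <= absz r)%N.
    apply: mins; apply/asboolP; split; first by rewrite absz_gt0.
    by exists (q - d * q0), (b - d *: b0) => j; rewrite gez0_abs.
  by rewrite leqNgt -ltz_nat gez0_abs // r_lt.
have [k [qk bk]] : exists k, q - d * q0 = k * p /\ b - d *: b0 = k *: a.
  apply: pa; apply/rowP => j; move: (Hr j); rewrite r0 mul0r => /eqP.
  rewrite mulf_eq0 gt_eqF //= subr_eq0 => /eqP H.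
  by rewrite [LHS]mxE [RHS]mxE -H.
by exists k, d; rewrite -qk -bk !subrK.
Qed.

(** Adding multiples of [(p, a)] to the second basis vector does not change [p *: a' - p' *: a].
    Hence [s] is fixed before [B], and [p'] can grow freely. *)
Lemma plane_basis_large (n : nat) (p : int) (a v : 'rV[int]_n) (i : 'I_n) :
  0 < p -> primitive_point p a -> v 0 i != 0 ->
  exists2 s : int, 0 < s & forall B : int, exists (p' : int) (a' : 'rV[int]_n),
    [/\ B <= p',
        (forall j, v 0 i ^+ 2 * (p * a' 0 j - p' * a 0 j) = s * v 0 j)
      & (forall q b, in_plane p a v i q b ->
           exists k l : int, q = k * p + l * p' /\ b = k *: a + l *: a')].
Proof.
move=> p0 pa vi; have [s s0 [q0 [b0 [Hs basis]]]] := plane_basis p0 pa vi.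
exists s => // B; pose k : int := `|B| + `|q0|.
exists (q0 + k * p), (b0 + k *: a); split.
- have : k <= k * p by rewrite ler_peMr // /k addr_ge0.
  rewrite /k => kp.
  have := ler_norm B; have := ler_norm (- q0); rewrite normrN; lia.
- by move=> j; rewrite -Hs !mxE; ring.
- move=> q b /basis[l [m [-> ->]]]; exists (l - m * k), m; split; first ring.
  by apply/rowP => j; rewrite !mxE; ring.
Qed.

(** A point proportional to [(p', a')] lies in the plane, and its coordinate along [(p, a)] vanishes
    because the basis vectors are independent. *)
Lemma primitive_point_basis (n : nat) (p p' s : int) (a a' v : 'rV[int]_n)
    (i : 'I_n) :
  0 < p' -> 0 < s -> v 0 i != 0 ->
  (forall j, v 0 i ^+ 2 * (p * a' 0 j - p' * a 0 j) = s * v 0 j) ->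
  (forall q b, in_plane p a v i q b ->
     exists k l : int, q = k * p + l * p' /\ b = k *: a + l *: a') ->
  primitive_point p' a'.
Proof.
move=> p'0 s0 vi Hs basis q b qb.
have qbj j : q * a' 0 j = p' * b 0 j by move/rowP/(_ j): qb; rewrite !mxE.
have [|k [l [qE bE]]] := basis q b.
  move=> j.
  have H k : (v 0 i ^+ 2 * p') * (p * b 0 k - q * a 0 k) = q * (s * v 0 k).
    rewrite -Hs; have -> : (v 0 i ^+ 2 * p') * (p * b 0 k - q * a 0 k)
      = v 0 i ^+ 2 * (p * (p' * b 0 k) - q * p' * a 0 k) by ring.
    by rewrite -qbj; ring.
  have c0 : v 0 i ^+ 2 * p' != 0 by rewrite mulf_neq0 ?sqrf_eq0 // gt_eqF.
  apply: (mulfI c0).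
  rewrite mulrCA H (mulrCA (_ * p')) H; ring.
exists l; suff k0 : k = 0 by rewrite qE bE k0 mul0r scale0r !add0r.
have H : k * (s * v 0 i) = 0.
  rewrite -Hs; move: (qbj i); rewrite qE bE !mxE => /eqP.
  rewrite -subr_eq0 => /eqP e.
  have -> : k * (v 0 i ^+ 2 * (p * a' 0 i - p' * a 0 i)) = v 0 i ^+ 2 *
    ((k * p + l * p') * a' 0 i - p' * (k * a 0 i + l * a' 0 i)) by ring.
  by rewrite e mulr0.
by move/eqP: H; rewrite !mulf_eq0 (gt_eqF s0) (negPf vi) !orbF => /eqP.
Qed.

(** * Rational approximations in a prescribed direction *)

Definition rational_point (R : realType) (n : nat) (p : int) (a : 'rV[int]_n) :
  'rV[R]_n := p%:~R^-1 *: intv a.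

Definition affine_form (R : realType) (n : nat) (c0 : int) (c : 'rV[int]_n)
    (x : 'rV[R]_n) : R := c0%:~R + \sum_(i < n) (c 0 i)%:~R * x 0 i.

Lemma rational_pointK (R : realType) (n : nat) (p : int) (a : 'rV[int]_n) :
  0 < p -> p%:~R *: rational_point R p a = intv a.
Proof. by move=> p0; rewrite scalerA divff ?scale1r // intr_eq0 gt_eqF. Qed.

Lemma intvD (R : realType) (n : nat) (a b : 'rV[int]_n) :
  intv (a + b) = intv a + intv b :> 'rV[R]_n.
Proof. exact: map_mxD. Qed.

Lemma intvZ (R : realType) (n : nat) (k : int) (a : 'rV[int]_n) :
  intv (k *: a) = k%:~R *: intv a :> 'rV[R]_n.
Proof. exact: map_mxZ. Qed.

(** Rounding [N%:R *: theta] gives [v0]; if [v0] is orthogonal to [c], then [v0 + c] is not. Moving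
    along [v] therefore leaves any hyperplane with normal [c]. *)
Lemma integer_direction (R : realType) (n : nat) (theta : 'rV[R]_n) (d : R)
    (c : 'rV[int]_n) : 0 < d ->
  exists (v : 'rV[int]_n) (N : nat), [/\ (0 < N)%N,
    `|N%:R^-1 *: intv v - theta| <= d
    & c <> 0 -> \sum_i c 0 i * v 0 i != 0].
Proof.
(* The [1] pays for the rounding, the norm of [c] for the possible correction. *)
move=> d0; pose K : R := (1 + `|intv c|) / d.
have K0 : 0 <= K by rewrite divr_ge0 ?addr_ge0 // ltW.
pose N := Num.bound K; have KN : K < N%:R := archi_boundP K0.
have N0 : 0 < N%:R :> R := le_lt_trans K0 KN.
have dN : 1 + `|intv c : 'rV[R]_n| <= d * N%:R.
  by rewrite mulrC -ler_pdivrMr // ltW.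
pose v0 : 'rV[int]_n := \row_i Num.floor (N%:R * theta 0 i).
have close (w : 'rV[int]_n) : w = 0 \/ w = c ->
    `|N%:R^-1 *: intv (v0 + w) - theta| <= d.
  move=> wc; have w_le i : `|(w 0 i)%:~R : R| <= `|intv c : 'rV[R]_n|.
    case: wc => ->; first by rewrite mxE normr0.
    by have := rV_norm_ge (intv c : 'rV[R]_n) i; rewrite mxE.
  apply/rV_norm_leP => [|i]; first exact: ltW.
  have -> : (N%:R^-1 *: intv (v0 + w) - theta) 0 i =
      ((Num.floor (N%:R * theta 0 i))%:~R - N%:R * theta 0 i + (w 0 i)%:~R) / N%:R.
    by rewrite !mxE intrD; field; rewrite gt_eqF.
  rewrite normrM normfV (gtr0_norm N0) ler_pdivrMr //.
  apply: le_trans (ler_normD _ _) _; apply: le_trans _ dN.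
  apply: lerD => //; rewrite distrC ger0_norm ?subr_ge0 ?floor_le //.
  by have /andP[_] := floor_itv (N%:R * theta 0 i); rewrite intrD; lra.
have [cv|cv] := eqVneq (\sum_i c 0 i * v0 0 i) 0; last first.
  by exists (v0 + 0), N; split; [rewrite -(ltr0n R)|apply: close; left|rewrite addr0].
exists (v0 + c), N; split; [by rewrite -(ltr0n R)|by apply: close; right|].
move=> /eqP/rV0Pn[i ci].
under eq_bigr do rewrite mxE mulrDr.
rewrite big_split /= cv add0r gt_eqF // (bigD1 i) //=.
rewrite ltr_pwDl ?sumr_ge0 // => [|j _]; last by rewrite -expr2 sqr_ge0.
by rewrite -expr2 lt_neqAle sqr_ge0 andbT eq_sym sqrf_eq0.
Qed.

(* The 2x2 minors of [v] against [q alpha - b] do not see the displacement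
   along [v]; times [p] they are integers. *)
Lemma off_plane_gap (R : realType) (n : nat) (p : int) (a v : 'rV[int]_n) i
    (alpha : 'rV[R]_n) (t : R) q b :
  0 < p -> p%:~R *: alpha - intv a = t *: intv v -> ~ in_plane p a v i q b ->
  1 <= 2 * p%:~R * `|intv v : 'rV[R]_n| * `|q%:~R *: alpha - intv b|.
Proof.
move=> p0 alphaE /existsNP[j /eqP nj].
set x := _ - intv b; have pR : 0 < p%:~R :> R by rewrite ltr0z.
have xE k : p%:~R * x 0 k = 
    (q * a 0 k)%:~R + q%:~R * t * (v 0 k)%:~R - (p * b 0 k)%:~R :> R.
  move/rowP/(_ k): alphaE; rewrite !mxE => alphak.
  have -> : p%:~R * (q%:~R * alpha 0 k - (b 0 k)%:~R)
    = q%:~R * (p%:~R * alpha 0 k - (a 0 k)%:~R) + q%:~R * (a 0 k)%:~R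
      - p%:~R * (b 0 k)%:~R by ring.
  by rewrite alphak !intrM; ring.
have minor : p%:~R * ((v 0 j)%:~R * x 0 i - (v 0 i)%:~R * x 0 j) =
    (v 0 i * (p * b 0 j - q * a 0 j) - v 0 j * (p * b 0 i - q * a 0 i))%:~R :> R.
  rewrite mulrBr !(mulrCA p%:~R) !xE !(intrM, intrB, intz); ring.
have ge1 : 1 <= p%:~R * `|(v 0 j)%:~R * x 0 i - (v 0 i)%:~R * x 0 j|.
  rewrite -[p%:~R]gtr0_norm // -normrM minor -intr_norm ler1z.
  by rewrite -gtz0_ge1 normr_gt0 subr_eq0.
apply: le_trans ge1 _.
rewrite (mulrC 2) -!mulrA ler_pM2l //; apply: le_trans (ler_normB _ _) _.
rewrite mulrDl mul1r !normrM.
have vk k : `|(v 0 k)%:~R : R| <= `|intv v : 'rV[R]_n|.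
  by have := rV_norm_ge (intv v : 'rV[R]_n) k; rewrite mxE.
by apply: lerD; apply: ler_pM => //; exact: rV_norm_ge.
Qed.

(** Along the candidates [a' / p'] an affine form takes the values [h + e / p'], which vanish for at
    most one [p']; large denominators avoid the hyperplane. *)
Lemma affine_hyperbola_neq0 (R : realFieldType) (h e : R) : h != 0 \/ e != 0 ->
  exists K, forall x, K <= x -> 0 < x -> h + e / x != 0.
Proof.
have [->|h0] := eqVneq h 0.
  case=> // e0; exists 0 => x _ x0.
  by rewrite add0r mulf_neq0 // invr_eq0 gt_eqF.
move=> _; exists (`|e| / `|h| + 1) => x Kx x0; apply/eqP => /eqP.
rewrite addr_eq0 => /eqP hE; move: Kx; rewrite hE normrN normf_div (gtr0_norm x0).
have [e0|e0] := eqVneq e 0.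
  by move: h0; rewrite hE e0 mul0r oppr0 eqxx.
have -> : `|e| / (`|e| / x) = x by field; rewrite normr_eq0 e0 gt_eqF.
lra.
Qed.

Lemma is_norm_le_close (R : realType) (n : nat) (f : 'rV[R]_n -> R) (C rho : R)
    (q m : int) (b : 'rV[int]_n) (alpha alpha' : 'rV[R]_n) :
  is_norm f -> (forall x, f x <= C * `|x|) -> 0 <= C -> 0 <= q -> q <= m ->
  `|alpha - alpha'| <= rho ->
  f (q%:~R *: alpha - intv b) <= f (q%:~R *: alpha' - intv b) + m%:~R * C * rho.
Proof.
move=> nf HC C0 q0 qm close.
rewrite (_ : _ *: alpha - _ = (q%:~R *: alpha' - intv b) + q%:~R *: (alpha - alpha')).
  apply: le_trans (is_norm_triangle nf _ _) _; rewrite lerD2l (is_normZ nf).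
  rewrite ger0_norm ?ler0z // -mulrA; apply: ler_pM; rewrite ?ler0z ?ler_int //.
    by have [_ f0 _ _ _] := nf.
  by apply: le_trans (HC _) _; exact: ler_wpM2l.
by apply/rowP => i; rewrite !mxE; ring.
Qed.

Lemma affine_form_close (R : realType) (n : nat) (c0 : int) (c : 'rV[int]_n)
    (x y : 'rV[R]_n) :
  `|affine_form c0 c x - affine_form c0 c y|
    <= (\sum_i `|(c 0 i)%:~R|) * `|x - y|.
Proof.
rewrite /affine_form opprD addrACA subrr add0r -sumrB mulr_suml.
apply: le_trans (ler_norm_sum _ _ _) _; apply: ler_sum => i _.
rewrite -mulrBr normrM ler_wpM2l //.
by have := rV_norm_ge (x - y) i; rewrite !mxE.
Qed.

(** At [a' / p'] the point [k *: (p, a) + l *: (p', a')] has remainder [k *: xi], so only [|k| <= 1]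
    can compete with [(p, a)]. *)
Lemma combination_in_range (p p' k l : int) : 0 < p -> p < p' ->
  1 <= k * p + l * p' -> k * p + l * p' <= p' ->
  [\/ 2 <= `|k|, k = 0 /\ l = 1, k = 1 /\ l = 0 | k = -1 /\ l = 1].
Proof.
move=> p0 pp' H1 H2; have [k2|k2] := leP 2 `|k|; first by constructor 1.
have : k = 0 \/ k = 1 \/ k = -1 by lia.
case=> [ek|[ek|ek]]; rewrite ek in H1 H2.
- by constructor 2; split=> //; nia.
- by constructor 3; split=> //; nia.
- by constructor 4; split=> //; nia.
Qed.

(** Everything follows from taking [p'] large: [xi] shrinks like [1 / p'] while the gap off the
    plane is fixed. The factor [2] leaves room to move [alpha] later; [(p' - p, a' - a)] is excluded
    because its remainder is [- xi]. *)
Lemma next_rational_point (R : realType) (n : nat) (f : 'rV[R]_n -> R)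
    (theta : 'rV[R]_n) (eta r : R) (p : int) (a : 'rV[int]_n)
    (c0 : int) (c : 'rV[int]_n) :
  is_norm f -> f theta = 1 -> 0 < eta -> 0 < r ->
  0 < p -> primitive_point p a -> c0 <> 0 \/ c <> 0 ->
  exists (p' : int) (a' : 'rV[int]_n), let alpha := rational_point R p' a' in
    let xi := p%:~R *: alpha - intv a in
    [/\ p < p', primitive_point p' a',
        `|alpha - rational_point R p a| <= r,
        affine_form c0 c alpha != 0
      & [/\ xi <> 0, `|(f xi)^-1 *: xi - theta| < eta
        & forall q b, 1 <= q -> q <= p' -> (q, b) <> (p, a) ->
            (q, b) <> (p', a') -> (q, b) <> (p' - p, a' - a) ->
            2 * f xi <= f (q%:~R *: alpha - intv b)]].
Proof.
move=> nf ftheta eta0 r0 p0 pa cc.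
have [cl cl0 Hcl] := is_norm_lower nf.
have fZ := is_normZ nf.
have theta0 : theta <> 0.
  move=> t0; have [_ _ f00 _ _] := nf; move: ftheta.
  by rewrite t0 (f00 0).2 // => /esym/eqP; rewrite oner_eq0.
have [d d0 Hd] := is_norm_normalize_cvg nf theta0 eta0.
have [v [N [N0 vN cv]]] := integer_direction theta c d0.
have {Hd vN} [v0 vtheta] := Hd _ vN.
have NR : 0 < N%:R^-1 :> R by rewrite invr_gt0 ltr0n.
have {v0} vn0 : v != 0.
  by apply/eqP => ve; apply: v0; apply/rowP => i; rewrite ve !mxE mulr0.
have intv0 : (intv v : 'rV[R]_n) <> 0.
  move/rV0Pn: vn0 => [i vi] /rowP/(_ i); rewrite !mxE => /eqP.
  by rewrite intr_eq0 (negPf vi).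
have fv : 0 < f (intv v) := is_norm_gt0 nf intv0.
have nv : 0 < `|intv v : 'rV[R]_n| by rewrite normr_gt0; apply/eqP.
have {}vtheta : `|(f (intv v))^-1 *: intv v - theta| < eta.
  move: vtheta; rewrite ftheta invr1 scale1r fZ gtr0_norm // scalerA.
  by rewrite invfM mulrAC mulVf ?gt_eqF // mul1r.
have [i vi] := rV0Pn _ vn0.
have [s s0 Hs] := plane_basis_large p0 pa vi.
have pR : 0 < p%:~R :> R by rewrite ltr0z.
have sR : 0 < s%:~R :> R by rewrite ltr0z.
have viR0 : (v 0 i)%:~R != 0 :> R by rewrite intr_eq0.
have viR : 0 < (v 0 i)%:~R ^+ 2 :> R.
  by rewrite lt_neqAle sqr_ge0 andbT eq_sym sqrf_eq0.
(* [T] is the constant with [p *: a' - p' *: a = T *: v], so that [xi = (T / p') *: v]. *)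
have [T T0 TE] : exists2 T : R, 0 < T & T = s%:~R / (v 0 i)%:~R ^+ 2.
  by eexists; last reflexivity; rewrite divr_gt0.
pose e : R := T / p%:~R * (\sum_j c 0 j * v 0 j)%:~R.
have [K HK] : exists K, forall x, K <= x -> 0 < x ->
    affine_form c0 c (rational_point R p a) + e / x != 0.
  apply: affine_hyperbola_neq0.
  have [ce|/eqP ce] := eqVneq c 0; last first.
    by right; rewrite /e mulf_neq0 // ?intr_eq0 ?cv // gt_eqF // divr_gt0.
  left; rewrite /affine_form big1 ?addr0 => [|j _]; last by rewrite ce mxE mul0r.
  by case: cc => // /eqP; rewrite intr_eq0.
(* [K1 <= p'] keeps [alpha] within [r] of [a / p]; [K2 <= p'] puts [2 * f xi] below the off-plane
   bound [cl / (2 * p * |v|)]. *)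
pose K1 : R := T * `|intv v : 'rV[R]_n| / (p%:~R * r).
pose K2 : R := 4 * T * f (intv v) * p%:~R * `|intv v : 'rV[R]_n| / cl.
have K10 : 0 < K1 by rewrite divr_gt0 ?mulr_gt0.
have K20 : 0 < K2 by rewrite divr_gt0 ?mulr_gt0.
have [p' [a' [Bp' Ha' basis]]] := Hs (Num.max (p + 1) (Num.ceil (K1 + K2 + `|K|))).
move: Bp'; rewrite ge_max => /andP[pp' Kp'].
have {pp'}pp' : p < p' by rewrite -lezD1.
have {}Kp' : K1 + K2 + `|K| <= p'%:~R.
  by apply: le_trans (ceil_ge _) _; rewrite ler_int.
have p'0 : 0 < p' := lt_trans p0 pp'.
have p'R : 0 < p'%:~R :> R by rewrite ltr0z.
exists p', a' => alpha xi.
have xiE : xi = (T / p'%:~R) *: intv v.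
  apply/rowP => j; rewrite /xi /alpha /rational_point !mxE TE.
  have := congr1 (fun z : int => z%:~R : R) (Ha' j).
  rewrite !(intrM, intrB, intz) => H.
  apply: (mulfI (lt0r_neq0 viR)); apply: (mulfI (lt0r_neq0 p'R)).
  transitivity ((s%:~R : R) * (v 0 j)%:~R); last by field; rewrite ?viR0 gt_eqF.
  by rewrite -H; field; rewrite gt_eqF.
have fxi : f xi = T / p'%:~R * f (intv v) by rewrite xiE fZ gtr0_norm ?divr_gt0.
have alphaE : alpha - rational_point R p a = (T / p'%:~R / p%:~R) *: intv v.
  rewrite mulrC -scalerA -xiE /xi scalerBr scalerA mulVf ?gt_eqF //.
  by rewrite scale1r.
split=> //.
- exact: (primitive_point_basis p'0 s0 vi Ha' basis).
- rewrite alphaE normrZ gtr0_norm ?divr_gt0 //.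
  have : K1 <= p'%:~R by have := normr_ge0 K; lra.
  rewrite /K1 ler_pdivrMr ?mulr_gt0 // => H.
  have -> : T / p'%:~R / p%:~R * `|intv v : 'rV[R]_n|
      = T * `|intv v : 'rV[R]_n| / (p'%:~R * p%:~R) by field; rewrite !gt_eqF.
  by rewrite ler_pdivrMr ?mulr_gt0 // mulrCA (mulrC r).
- have -> : affine_form c0 c alpha = affine_form c0 c (rational_point R p a) + e / p'%:~R.
    rewrite -[alpha](subrK (rational_point R p a)) alphaE /affine_form -addrA.
    congr (_ + _); rewrite /e (rmorph_sum (intmul 1)) /= mulr_sumr mulr_suml -big_split /=.
    apply: eq_bigr => j _; rewrite !mxE !intrM; ring.
  by apply: HK => //; have := ler_norm K; lra.
split.
- move=> xi0; have [_ _ f00 _ _] := nf; move: fxi.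
  by rewrite xi0 (f00 0).2 // => /esym/eqP; rewrite gt_eqF // mulr_gt0 ?divr_gt0.
- rewrite fxi xiE scalerA invfM mulrAC mulVf ?mul1r //.
  by rewrite gt_eqF // divr_gt0.
move=> q b q1 qp' n1 n2 n3.
have [/basis[k [l [qE bE]]]|np] := pselect (in_plane p a v i q b).
  have -> : q%:~R *: alpha - intv b = k%:~R *: xi.
    rewrite qE bE intvD !intvZ /xi -(rational_pointK R a' p'0) -/alpha.
    rewrite intrD !intrM scalerDl scalerBr !scalerA.
    by apply/rowP => j; rewrite !mxE; ring.
  rewrite fZ; apply: ler_wpM2r; first by have [_ f0 _ _ _] := nf.
  rewrite -intr_norm (_ : 2 = 2%:~R) // ler_int.
  rewrite qE in q1 qp'.
  have [//|[k0 l1]|[k1 l0]|[k1 l1]] := combination_in_range p0 pp' q1 qp'; exfalso.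
  + by apply: n2; rewrite qE bE k0 l1 mul0r scale0r !add0r mul1r scale1r.
  + by apply: n1; rewrite qE bE k1 l0 mul0r scale0r !addr0 mul1r scale1r.
  + by apply: n3; rewrite qE bE k1 l1 !mulN1r !scaleN1r mul1r scale1r addrC (addrC (- a)).
have gap := off_plane_gap p0 xiE np.
apply: le_trans (Hcl _).
have : K2 <= p'%:~R by have := normr_ge0 K; lra.
rewrite /K2 ler_pdivrMr // => H.
rewrite fxi -(ler_pM2l p'R) mulrCA (mulrA p'%:~R) (mulrCA p'%:~R) divff ?gt_eqF // mulr1.
set y := `|_ *: alpha - _| in gap *.
have {}H : 4 * T * f (intv v) * p%:~R * `|intv v : 'rV[R]_n| * y <= p'%:~R * cl * y.
  by apply: ler_wpM2r => //; exact: normr_ge0.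
have := ler_wpM2l (ltW (mulr_gt0 T0 fv)) gap.
lra.
Qed.

(** The conclusions at [a' / p'] have slack, so they persist on a closed ball around it, contained
    in the previous one. The competitor [(p' - p, a' - a)] stays undecided: its tie depends on the
    next direction. *)
Lemma approximation_step (R : realType) (n : nat) (f : 'rV[R]_n -> R)
    (theta : 'rV[R]_n) (eta r : R) (p : int) (a : 'rV[int]_n)
    (c0 : int) (c : 'rV[int]_n) :
  is_norm f -> f theta = 1 -> 0 < eta -> 0 < r ->
  0 < p -> primitive_point p a -> c0 <> 0 \/ c <> 0 ->
  exists (p' : int) (a' : 'rV[int]_n) (r' : R),
    [/\ p < p', primitive_point p' a', 0 < r',
        `|rational_point R p' a' - rational_point R p a| + r' <= r
      & forall alpha, `|alpha - rational_point R p' a'| <= r' ->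
        let xi := p%:~R *: alpha - intv a in
        [/\ affine_form c0 c alpha != 0,
            `|(f xi)^-1 *: xi - theta| < eta,
            f (p'%:~R *: alpha - intv a') < f xi
          & forall q b, 1 <= q -> q <= p' -> (q, b) <> (p, a) ->
            (q, b) <> (p', a') -> (q, b) <> (p' - p, a' - a) ->
            f xi < f (q%:~R *: alpha - intv b)]].
Proof.
move=> nf ftheta eta0 r0 p0 pa cc.
have eta2 : 0 < eta / 2 by rewrite divr_gt0.
have r2 : 0 < r / 2 by rewrite divr_gt0.
have [p' [a' [pp' pa' close aff [xi0 xitheta gap]]]] :=
  next_rational_point nf ftheta eta2 r2 p0 pa cc.
set beta := rational_point R p' a' in close aff xi0 xitheta gap *.
set x0 := p%:~R *: beta - intv a in xi0 xitheta gap.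
have [C C0 HC] := is_norm_upper nf.
have fx0 := is_norm_gt0 nf xi0.
have [d d0 Hd] := is_norm_normalize_cvg nf xi0 eta2.
have p'0 : 0 < p' := lt_trans p0 pp'.
have pR : 0 < p%:~R :> R by rewrite ltr0z.
have p'R : 0 < p'%:~R :> R by rewrite ltr0z.
pose S : R := \sum_i `|(c 0 i)%:~R|.
have S0 : 0 <= S by apply: sumr_ge0.
pose A : R := `|affine_form c0 c beta|.
have A0 : 0 < A by rewrite normr_gt0.
(* The four bounds serve, in order, nesting, the direction of [xi], the hyperplane, and a variation
   of at most [f x0 / 4] for every remainder with denominator up to [p']. *)
pose r' := Num.min (Num.min (r / 2) (d / p%:~R))
                   (Num.min (A / (2 * (S + 1))) (f x0 / (4 * (p'%:~R * C)))).
have S1 : 0 < 2 * (S + 1) by rewrite mulr_gt0 // ltr_wpDl.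
have D1 : 0 < 4 * (p'%:~R * C) by rewrite !mulr_gt0.
exists p', a', r'; split=> //.
- by rewrite !lt_min !divr_gt0.
- suff : r' <= r / 2 by lra.
  by rewrite !ge_min lexx.
move=> alpha alpha_close xi.
have [rd rS rC] : [/\ p%:~R * r' <= d, 2 * (S + 1) * r' <= A & 4 * (p'%:~R * C) * r' <= f x0].
  by split; rewrite -ler_pdivlMl // [X in _ <= X]mulrC !ge_min lexx ?orbT.
have lip q m b := is_norm_le_close (q := q) (m := m) b nf HC (ltW C0).
have close' : `|beta - alpha| <= r' by rewrite distrC.
have Crho : p'%:~R * C * r' <= f x0 / 4 by lra.
have xi_le : f xi <= f x0 + p'%:~R * C * r' by apply: lip => //; exact: ltW.
have xi_ge : f x0 <= f xi + p'%:~R * C * r' by apply: lip => //; exact: ltW.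
split.
- apply/eqP => aff0; have := affine_form_close c0 c beta alpha.
  rewrite aff0 subr0 -/A -/S => H.
  have : A <= S * r' by apply: le_trans H _; apply: ler_wpM2l.
  have : 0 <= r' by apply: le_trans close'.
  by nra.
- have [|_] := Hd xi.
    rewrite (_ : xi - x0 = p%:~R *: (alpha - beta)).
      by rewrite normrZ gtr0_norm //; apply: le_trans rd; rewrite ler_pM2l.
    by apply/rowP => j; rewrite !mxE; ring.
  move=> H; apply: le_lt_trans (_ : _ <= `|((f xi)^-1 *: xi - (f x0)^-1 *: x0)
     + ((f x0)^-1 *: x0 - theta)|) _.
    by rewrite addrA subrK.
  by apply: le_lt_trans (ler_normD _ _) _; lra.
- have : f (p'%:~R *: alpha - intv a') <= f (p'%:~R *: beta - intv a') + p'%:~R * C * r'.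
    by apply: lip => //; exact: ltW.
  rewrite /beta rational_pointK // subrr; have [_ _ f00 _ _] := nf.
  rewrite (f00 0).2 //; lra.
move=> q b q1 qp' n1 n2 n3; have := gap q b q1 qp' n1 n2 n3.
have : f (q%:~R *: beta - intv b) <= f (q%:~R *: alpha - intv b) + p'%:~R * C * r'.
  by apply: lip => //; exact: le_trans ler01 q1.
lra.
Qed.

(** * Passage to the limit *)

(** In each coordinate the balls are nested intervals; the supremum of the left ends lies in all of
    them. *)
Lemma nested_balls (R : realType) (n : nat) (c : nat -> 'rV[R]_n) (r : nat -> R) :
  (forall k, 0 <= r k) -> (forall k, `|c k.+1 - c k| + r k.+1 <= r k) ->
  exists x, forall k, `|x - c k| <= r k.
Proof.
move=> r0 nest.
have step k i : c k 0 i - r k <= c k.+1 0 i - r k.+1 /\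
                c k.+1 0 i + r k.+1 <= c k 0 i + r k.
  have := rV_norm_ge (c k.+1 - c k) i; have := nest k.
  by rewrite !mxE ler_norml => nest_k /andP[]; split; lra.
have mono i k m : (k <= m)%N -> c k 0 i - r k <= c m 0 i - r m /\
                               c m 0 i + r m <= c k 0 i + r k.
  elim: m => [|m IH]; first by rewrite leqn0 => /eqP ->.
  rewrite leq_eqVlt ltnS => /orP[/eqP -> //|/IH[]].
  by have [] := step m i; split; lra.
pose E i := [set c k 0 i - r k | k in [set: nat]].
have Eub i m : ubound (E i) (c m 0 i + r m).
  move=> _ [k _ <-].
  have [H1 _] := mono i k (maxn k m) (leq_maxl _ _).
  have [_ H2] := mono i m (maxn k m) (leq_maxr _ _).
  by have := r0 (maxn k m); lra.
exists (\row_i sup (E i)) => k; apply/rV_norm_leP => // i; rewrite !mxE.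
rewrite ler_distl; apply/andP; split.
  by apply: ub_le_sup; [exists (c k 0 i + r k)|exists k].
by apply: ge_sup; [exists (c k 0 i - r k), k|].
Qed.

(** Reduces rational relations to the integer affine forms that the construction enumerates. *)
Lemma clear_denominators (R : realType) (n : nat) (c0 : rat) (c : 'rV[rat]_n)
    (x : 'rV[R]_n) : c0 <> 0 \/ c <> 0 ->
  ratr c0 + \sum_(i < n) ratr (c 0 i) * x 0 i = 0 ->
  exists (z0 : int) (z : 'rV[int]_n),
    (z0 <> 0 \/ z <> 0) /\ affine_form z0 z x = 0.
Proof.
move=> cc rel.
pose P := \prod_j denq (c 0 j); pose d := denq c0 * P.
have P0 : P != 0 by apply/prodf_neq0 => j _; rewrite denq_neq0.
have d0 : d != 0 by rewrite mulf_neq0 ?denq_neq0.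
pose z0 := numq c0 * P.
pose z : 'rV[int]_n :=
  \row_i (denq c0 * (numq (c 0 i) * \prod_(j < n | j != i) denq (c 0 j))).
have z0E : (z0%:~R : rat) = d%:~R * c0.
  by rewrite /z0 /d !intrM numqE; ring.
have zE i : ((z 0 i)%:~R : rat) = d%:~R * c 0 i.
  by rewrite mxE /d /P [in RHS](bigD1 i) //= !intrM numqE; ring.
have dQ : d%:~R != 0 :> rat by rewrite intr_eq0.
have toR (w : int) (y : rat) : (w%:~R : rat) = d%:~R * y ->
    (w%:~R : R) = d%:~R * ratr y.
  by move=> /(congr1 (fun y => ratr y : R)); rewrite rmorphM /= !ratr_int.
exists z0, z; split.
  case: cc => cn0; [left=> ze|right=> ze]; apply: cn0.
    by apply: (mulfI dQ); rewrite -z0E ze mulr0.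
  by apply/rowP => i; apply: (mulfI dQ); rewrite -zE ze !mxE mulr0.
rewrite /affine_form (toR _ _ z0E).
under eq_bigr do rewrite (toR _ _ (zE _)) -mulrA.
by rewrite -mulr_sumr -mulrDr rel mulr0.
Qed.

(** Up to denominator [(pa nu.+1).1], only [pa nu.+1] does at least as well as [pa nu]. This makes
    each term a best approximation and leaves no place for others between consecutive terms. *)
Lemma best_approx_seq_of_gaps (R : realType) (n : nat) (f : 'rV[R]_n -> R)
    (alpha : 'rV[R]_n) (pa : nat -> int * 'rV[int]_n) :
  (pa 0).1 = 1 -> (forall nu, (pa nu).1 < (pa nu.+1).1) ->
  (forall nu, f ((pa nu.+1).1%:~R *: alpha - intv (pa nu.+1).2) <
              f ((pa nu).1%:~R *: alpha - intv (pa nu).2)) ->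
  (forall nu q b, 1 <= q -> q <= (pa nu.+1).1 -> (q, b) <> pa nu ->
     (q, b) <> pa nu.+1 ->
     f ((pa nu).1%:~R *: alpha - intv (pa nu).2) < f (q%:~R *: alpha - intv b)) ->
  best_approx_seq f alpha pa.
Proof.
move=> p_init incr decr gap.
have p_ge nu : nu.+1%:Z <= (pa nu).1.
  elim: nu => [|nu IH]; first by rewrite p_init.
  by have := incr nu; lia.
split=> //.
- case=> [|nu]; split.
  + by rewrite p_init.
  + by move=> q b; rewrite p_init; lia.
  + move=> b bn; apply: gap; rewrite ?p_init //.
    * by have := incr 0%N; rewrite p_init; lia.
    * by case: (pa 0%N) bn => p a /= bn [_ /bn].
    * by move=> e; have := incr 0%N; rewrite -e p_init ltxx.
  + by have := p_ge nu.+1; lia.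
  + move=> q b q1 qp; have [e|ne] := pselect ((q, b) = pa nu).
      by have := decr nu; rewrite -e.
    apply: lt_trans (decr nu) _; apply: gap => //; first lia.
    by move=> e; move: qp; rewrite -e /=; lia.
  + move=> b bn; apply: lt_trans (decr nu) _; apply: gap => //.
    * by have := p_ge nu.+1; lia.
    * by move=> e; have := incr nu; rewrite -e ltxx.
    * by case: (pa nu.+1) bn => p a /= bn [/bn].
- move=> p a [p1 Hlt Hne].
  have exk : exists k, p < (pa k).1.
    by exists (absz p); have := p_ge (absz p); lia.
  (* The least index with denominator above [p] is not [0], since [(pa 0).1 = 1]; so [p] lies
     between two consecutive denominators. *)
  case: (ex_minnP exk) => [[|nu]]; first by rewrite p_init; lia.
  move=> pnu1 /(_ nu) minnu; exists nu.
  have {}minnu : (pa nu).1 <= p by rewrite leNgt; apply/negP => /minnu; rewrite ltnn.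
  apply: contrapT => ne.
  have lt1 : f ((pa nu).1%:~R *: alpha - intv (pa nu).2) < f (p%:~R *: alpha - intv a).
    apply: gap => //; first exact: ltW.
      by move=> e; apply: ne.
    by move=> e; move: pnu1; rewrite -e ltxx.
  have : f (p%:~R *: alpha - intv a) < f ((pa nu).1%:~R *: alpha - intv (pa nu).2).
    have [e|pne] := eqVneq (pa nu).1 p.
      rewrite e; apply: Hne => e2; apply: ne; rewrite -e -e2; exact: surjective_pairing.
    apply: Hlt; first by have := p_ge nu; lia.
    by move: pne minnu; lia.
  by move=> /(lt_trans lt1); rewrite ltxx.
Qed.

Theorem theorem2p6 (R : realType) (n : nat) (f : 'rV[R]_n -> R)
  (theta : nat -> 'rV[R]_n) :
  is_norm f ->
  (forall nu, f (theta nu) <= 1) ->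
  (forall nu, illuminated (ballf f (theta nu)) 0 (theta nu.+1)) ->
  exists alpha : 'rV[R]_n,
    Q_lin_indep_1 alpha /\
    exists pa : nat -> int * 'rV[int]_n,
      best_approx_seq f alpha pa /\
      (fun nu => let xi := ((pa nu).1)%:~R *: alpha - intv (pa nu).2 in
                 eucl ((f xi)^-1 *: xi - theta nu)) @ \oo --> (0 : R).
Proof.
move=> nf theta_le ill.
have fZ := is_normZ nf.
have ftheta nu : f (theta nu) = 1.
  by have [] := illuminated_ballf nf (theta_le nu) (ill nu).
have /choice[d Hd] : forall nu, exists e : R, 0 < e /\
    forall x y, `|x - theta nu| <= e -> `|y - theta nu.+1| <= e ->
      forall t, 0 < t -> f x < f (x - t *: y).
  move=> nu.
  by have [e e0 He] := illuminated_stable nf (theta_le nu) (ill nu); exists e.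
(* [theta nu] is the illuminated vector at [nu], hence [d nu], and the illuminating one at [nu.-1],
   hence [d nu.-1]; the last term gives convergence. *)
pose eta nu : R := Num.min (Num.min (d nu) (d nu.-1)) nu.+1%:R^-1.
have eta0 nu : 0 < eta nu.
  by rewrite !lt_min (Hd nu).1 (Hd nu.-1).1 invr_gt0 ltr0n.
have [hyp [hyp0 hypE]] : exists hyp : nat -> int * 'rV[int]_n,
    (forall nu, (hyp nu).1 <> 0 \/ (hyp nu).2 <> 0) /\
    (forall z0 z, z0 <> 0 \/ z <> 0 -> exists nu, hyp nu = (z0, z)).
  pose nonzero (z : int * 'rV[int]_n) := (z.1 != 0) || (z.2 != 0).
  (* Codes of no nonzero form are sent to the constant form [1], which vanishes nowhere. *)
  pose dflt := (1 : int, 0 : 'rV[int]_n).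
  exists (fun nu => let z := odflt dflt (unpickle nu) in
                    if nonzero z then z else dflt); split=> [nu|z0 z zz] /=.
    by case: ifP => [/orP[/eqP|/eqP]|_]; [left|right|left].
  exists (pickle (z0, z)); rewrite pickleK /= ifT //.
  by case: zz => /eqP zz; rewrite /nonzero zz ?orbT.
pose state : Type := (int * 'rV[int]_n * R)%type.
pose good (s : state) := [/\ 0 < s.1.1, primitive_point s.1.1 s.1.2 & 0 < s.2].
pose center (s : state) := rational_point R s.1.1 s.1.2.
pose next (nu : nat) (s s' : state) := [/\ s.1.1 < s'.1.1,
    `|center s' - center s| + s'.2 <= s.2
  & forall alpha, `|alpha - center s'| <= s'.2 ->
      let xi := s.1.1%:~R *: alpha - intv s.1.2 in
      [/\ affine_form (hyp nu).1 (hyp nu).2 alpha != 0,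
          `|(f xi)^-1 *: xi - theta nu| < eta nu,
          f (s'.1.1%:~R *: alpha - intv s'.1.2) < f xi
        & forall q b, 1 <= q -> q <= s'.1.1 -> (q, b) <> s.1 -> (q, b) <> s'.1 ->
            (q, b) <> (s'.1.1 - s.1.1, s'.1.2 - s.1.2) ->
            f xi < f (q%:~R *: alpha - intv b)]].
have /choice[F HF] : forall x : nat * state, exists s', good x.2 ->
    good s' /\ next x.1 x.2 s'.
  move=> [nu [[p a] r]].
  have [[/= p0 pa r0]|ng] := pselect (good (p, a, r)); last by exists (p, a, r).
  have [p' [a' [r' [H1 H2 H3 H4 H5]]]] :=
    approximation_step nf (ftheta nu) (eta0 nu) r0 p0 pa (hyp0 nu).
  by exists (p', a', r') => _; split; split=> //=; apply: lt_trans H1.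
(* The start [(1, 0)] has denominator [1], so no smaller denominator precedes it. *)
pose s := nat_rect (fun=> state) (1, 0, 1) (fun nu s => F (nu, s)).
have gs nu : good (s nu).
  elim: nu => [|nu IH]; last by have [] := HF (nu, s nu) IH.
  split=> //= q b; rewrite scale1r => <-; exists q.
  by rewrite mulr1 !scaler0.
have ns nu : next nu (s nu) (s nu.+1) by have [] := HF (nu, s nu) (gs nu).
have [alpha Halpha] : exists alpha, forall nu, `|alpha - center (s nu)| <= (s nu).2.
  apply: nested_balls => nu; first by have [_ _ /ltW] := gs nu.
  by have [] := ns nu.
pose pa nu := (s nu).1.
pose xi nu := (pa nu).1%:~R *: alpha - intv (pa nu).2.
have nsa nu := let: And3 _ _ H := ns nu in H alpha (Halpha nu.+1).
have decr nu : f (xi nu.+1) < f (xi nu) by have [] := nsa nu.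
have fpos nu : 0 < f (xi nu).
  by apply: le_lt_trans (decr nu); have [_ f0 _ _ _] := nf.
have Xi_close nu : `|(f (xi nu))^-1 *: xi nu - theta nu| < eta nu by have [] := nsa nu.
(* This breaks the tie with [pa nu.+1 - pa nu]: apply stability to the normalised [xi nu] and
   [xi nu.+1] with [t = f (xi nu.+1) / f (xi nu)], then multiply by [f (xi nu)]. *)
have backward nu : f (xi nu) < f (xi nu.+1 - xi nu).
  have [_ _ _ fN _] := nf; rewrite -[ltRHS]fN opprB.
  have Xi0 : `|(f (xi nu))^-1 *: xi nu - theta nu| <= d nu.
    by apply: le_trans (ltW (Xi_close nu)) _; rewrite !ge_min lexx.
  have Xi1 : `|(f (xi nu.+1))^-1 *: xi nu.+1 - theta nu.+1| <= d nu.
    by apply: le_trans (ltW (Xi_close nu.+1)) _; rewrite !ge_min lexx ?orbT.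
  have := (Hd nu).2 _ _ Xi0 Xi1 (f (xi nu.+1) / f (xi nu)) (divr_gt0 (fpos _) (fpos _)).
  rewrite scalerA mulrAC divff ?gt_eqF // mul1r -scalerBr !fZ.
  by rewrite gtr0_norm ?invr_gt0 // ltr_pM2l ?invr_gt0.
exists alpha; split.
  move=> c0 c rel; apply: contrapT => cc.
  have [|z0 [z [zz aff]]] := clear_denominators _ rel.
    have [e0|e0] := pselect (c0 = 0); last by left.
    by right=> ce; exact: cc (conj e0 ce).
  (* Step [nu] of the construction kept [alpha] off exactly this hyperplane. *)
  have [nu hypnu] := hypE _ _ zz.
  by have [/negP + _ _ _] := nsa nu; rewrite hypnu aff eqxx.
exists pa; split.
  apply: best_approx_seq_of_gaps => // [nu|nu q b q1 qp n1 n2].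
    by have [] := ns nu.
  have [[-> ->]|n3] := pselect ((q, b) = ((pa nu.+1).1 - (pa nu).1, (pa nu.+1).2 - (pa nu).2)).
    have -> : ((pa nu.+1).1 - (pa nu).1)%:~R *: alpha - intv ((pa nu.+1).2 - (pa nu).2)
        = xi nu.+1 - xi nu.
      by apply/rowP => i; rewrite !mxE !intrB; ring.
    exact: backward.
  by have [_ _ _] := nsa nu; apply.
apply: (@squeeze_cvgr _ _ _ _ (fun=> 0) (fun nu => Num.sqrt n%:R * nu.+1%:R^-1)).
- apply: nearW => nu; rewrite sqrtr_ge0 /=; apply: le_trans (eucl_le _) _.
  apply: ler_wpM2l; first exact: sqrtr_ge0.
  by apply: le_trans (ltW (Xi_close nu)) _; rewrite !ge_min lexx orbT.
- exact: cvg_cst.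
- rewrite -[X in _ --> X](mulr0 (Num.sqrt n%:R)); apply: cvgMr.
  exact: cvg_harmonic.
Qed.
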